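(* Let $q\in(0,1)$. Then $$\lim_{n\to\infty}\big(P_n^q(S_n(123))\big)^{\frac1{n^2}}=q^{\frac14}.$$
   Context: $S_n$ is the set of permutations $\sigma=\sigma_1\cdots\sigma_n$ of $[n]=\{1,\dots,n\}$, where $\sigma_i=\sigma(i)$. For $\tau\in S_m$ with $2\le m\le n$, $\sigma\in S_n$ contains $\tau$ as a pattern if there are indices $1\le i_1<\cdots<i_m\le n$ such that for all $1\le j,k\le m$, $\sigma_{i_j}<\sigma_{i_k}$ if and only if $\tau_j<\tau_k$; otherwise $\sigma$ avoids $\tau$. $S_n(\tau)$ is the set of $\sigma\in S_n$ avoiding $\tau$ (and $S_n(\tau)=S_n$ if $m>n$). For $q>0$, the Mallows distribution with parameter $q$ is the probability measure on $S_n$ given by $P_n^q(\sigma)=q^{\mathrm{inv}(\sigma)}/Z_n(q)$, where $\mathrm{inv}(\sigma)$ is the number of inversions of $\sigma$, i.e. pairs $i<j$ with $\sigma_i>\sigma_j$, and $Z_n(q)=\sum_{\sigma\in S_n}q^{\mathrm{inv}(\sigma)}$, which for $q\neq 1$ equals $\prod_{k=1}^n\frac{1-q^k}{1-q}$. *)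

(* Defs.v *)
From mathcomp Require Import all_boot all_order all_algebra all_fingroup.
From mathcomp Require Import all_classical all_reals all_analysis.

Set Implicit Arguments.
Unset Strict Implicit.
Unset Printing Implicit Defensive.

Import Order.TTheory GRing.Theory Num.Theory.

Local Open Scope ring_scope.

(* Positions and values are 0-based throughout: 'S_n acts on {0, ..., n-1}.   *)

(* For m > n there is no increasing i : 'I_m -> 'I_n, so [contains] is false. *)
Definition contains (n m : nat) (sigma : 'S_n) (tau : 'S_m) : bool :=
  [exists i : {ffun 'I_m -> 'I_n},
    [forall j : 'I_m, forall k : 'I_m, (j < k)%N ==> (i j < i k)%N] &&
    [forall j : 'I_m, forall k : 'I_m,
       (sigma (i j) < sigma (i k))%N == (tau j < tau k)%N]].

Definition avoiders (n m : nat) (tau : 'S_m) : {set 'S_n} :=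
  finset (fun sigma : 'S_n => ~~ contains sigma tau).

Definition inv (n : nat) (sigma : 'S_n) : nat :=
  #|finset (fun p : 'I_n * 'I_n =>
      (p.1 < p.2)%N && (sigma p.2 < sigma p.1)%N)|.

Definition mallows_Z (R : realType) (n : nat) (q : R) : R :=
  \sum_(sigma : 'S_n) q ^+ inv sigma.

Definition mallows_pmf (R : realType) (n : nat) (q : R) (sigma : 'S_n) : R :=
  q ^+ inv sigma / mallows_Z n q.

Definition mallows (R : realType) (n : nat) (q : R) (A : {set 'S_n}) : R :=
  \sum_(sigma in A) mallows_pmf q sigma.

(* 123 in one-line notation is the identity of S_3. *)
Definition pattern123 : 'S_3 := 1%g.

(* Main.v *)
(* The non-inversion graph of a 123-avoiding permutation is bipartite, so it has
   at most n^2/4 edges and the permutation has at least n^2/4 - n/2 inversions;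
   two consecutive decreasing blocks of lengths n/2 essentially attain this.
   Since 1 <= Z_n(q) <= n!, the probability lies between q^(n^2/4) / n! and
   n! q^(n^2/4 - n/2), and factorials disappear in the limit because
   ln n! <= n ln n = o(n^2). *)
Require Import Defs.
From mathcomp Require Import all_boot all_order all_algebra all_fingroup.
From mathcomp Require Import all_classical all_reals all_analysis.
From mathcomp Require Import zify ring lra.

Set Implicit Arguments.
Unset Strict Implicit.
Unset Printing Implicit Defensive.

Import Order.TTheory GRing.Theory Num.Theory.
Import numFieldNormedType.Exports.

Local Open Scope classical_set_scope.
Local Open Scope ring_scope.

Lemma leq_fact_expn n : (n`! <= n ^ n)%N.
Proof.
elim: n => // n IHn; rewrite factS expnS leq_mul2l /=.
by apply: leq_trans IHn _; case: n => // n; rewrite leq_exp2r.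
Qed.

(** * Occurrences of 123 and counts of inversions *)

Lemma contains123P n (sigma : 'S_n) :
  reflect (exists i j k : 'I_n, [/\ (i < j < k)%N,
             (sigma i < sigma j)%N & (sigma j < sigma k)%N])
          (contains sigma pattern123).
Proof.
pose a : 'I_3 := @Ordinal 3 0 isT; pose b : 'I_3 := @Ordinal 3 1 isT.
pose c : 'I_3 := @Ordinal 3 2 isT.
apply: (iffP existsP) => [[f /andP[/forallP hpos /forallP hval]]|].
  exists (f a), (f b), (f c).
  have pos (x y : 'I_3) : (x < y)%N -> (f x < f y)%N.
    by move=> xy; move/forallP/(_ y)/implyP: (hpos x); apply.
  have val (x y : 'I_3) : (x < y)%N -> (sigma (f x) < sigma (f y))%N.
    by move=> xy; move/forallP/(_ y)/eqP: (hval x) => ->; rewrite /pattern123 !perm1.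
  by rewrite !pos // !val.
move=> [i [j [k [/andP[ij jk] sij sjk]]]].
exists [ffun x : 'I_3 => tnth [tuple i; j; k] x].
apply/andP; split; apply/forallP => x; apply/forallP => y; rewrite !ffunE.
- by case: x => [[|[|[|x]]] hx] //; case: y => [[|[|[|y]]] hy] //;
    rewrite /= !(tnth_nth i) /=; lia.
- rewrite /pattern123 !perm1.
  by case: x => [[|[|[|x]]] hx] //; case: y => [[|[|[|y]]] hy] //;
    rewrite /= !(tnth_nth i) /=; lia.
Qed.

Definition noninversions n (sigma : 'S_n) : {set 'I_n * 'I_n} :=
  finset (fun p : 'I_n * 'I_n => (p.1 < p.2)%N && (sigma p.1 < sigma p.2)%N).

Lemma double_bin2 n : (2 * 'C(n, 2) + n = n ^ 2)%N.
Proof. by elim: n => // n IHn; rewrite binS bin1; lia. Qed.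

(** By injectivity every pair of positions is exactly one of an inversion and a non-inversion. A
    lower bound on one count thus becomes an upper bound on the other. *)
Lemma card_noninversions n (sigma : 'S_n) :
  (Defs.inv sigma + #|noninversions sigma| = 'C(n, 2))%N.
Proof.
rewrite -bin2_sum big_mkord /Defs.inv -cardsUI.
set I := finset.setI _ _; have -> : I = finset.set0.
  by apply/setP => -[i j]; rewrite !inE /=; lia.
rewrite cards0 addn0 -sum1_card.
rewrite (eq_bigl (fun p : 'I_n * 'I_n => true && (p.1 < p.2)%N)); last first.
  move=> [i j]; rewrite !inE /=; case: (ltnP i j) => //= ij.
  have : sigma i != sigma j.
    rewrite (inj_eq perm_inj); apply: contraTneq ij => ->.
    by rewrite ltnn.
  by rewrite -val_eqE /=; lia.
(* Grouping the pairs by their larger position [j] gives [j] pairs each, which matches the sum in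
   [bin2_sum]. *)
rewrite -(pair_big_dep xpredT (fun i j : 'I_n => (i < j)%N) (fun _ _ => 1%N)).
rewrite (exchange_big_dep xpredT) //=; apply: eq_bigr => j _.
rewrite -(big_mkord (fun i => (i < j)%N) (fun _ => 1%N)).
rewrite -(big_nat_widen 0 j n xpredT (fun _ => 1%N)) ?sum_nat_const_nat 1?ltnW //.
by rewrite subn0 muln1.
Qed.

(* An entry that is not a left-to-right minimum cannot start a non-inversion, so
   all non-inversions join a left-to-right minimum to an entry that is not one. *)
Lemma avoiders123_inv_ge n (sigma : 'S_n) :
  sigma \in avoiders n pattern123 -> (n ^ 2 <= 4 * Defs.inv sigma + 2 * n)%N.
Proof.
rewrite inE => /contains123P avoid.
pose B := finset (fun j : 'I_n =>
  [exists i : 'I_n, (i < j)%N && (sigma i < sigma j)%N]).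
have sub : noninversions sigma \subset finset.setX (finset.setC B) B.
  apply/fintype.subsetP => -[i j]; rewrite !inE /= => /andP[ij sij].
  apply/andP; split; last by apply/existsP; exists i; rewrite ij.
  apply/negP => /existsP[h /andP[hi shi]]; apply: avoid.
  by exists h, i, j; rewrite hi ij.
have := subset_leq_card sub; rewrite cardsX.
have := cardsC B; rewrite card_ord => cBC.
(* AM-GM: the two parts of the bipartition have total size [n], so the product of their sizes is at
   most n^2/4. *)
have [+ _] := nat_AGM2 #|finset.setC B| #|B|; rewrite addnC cBC.
have := card_noninversions sigma; have := double_bin2 n.
by move: (Defs.inv _) (n ^ 2)%N; lia.
Qed.

(** * A 123-avoiding permutation with few inversions *)

Lemma two_blocks_subproof n (i : 'I_n) :
  ((if (i < n./2)%N then n./2 - i.+1 else n + n./2 - i.+1) < n)%N.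
Proof. by case: ifP; have := ltn_ord i; lia. Qed.

(* In one-line notation: k-1 ... 0 n-1 ... k with k = n./2. *)
Definition two_blocks_fun n (i : 'I_n) : 'I_n :=
  Ordinal (two_blocks_subproof i).

Lemma two_blocks_inj n : injective (@two_blocks_fun n).
Proof.
move=> i j /(congr1 val) /= e; apply: val_inj => /=; move: e.
by have := ltn_ord i; have := ltn_ord j; do 2![case: ifP]; lia.
Qed.

Definition two_blocks n : 'S_n := perm (@two_blocks_inj n).

(** Each block is decreasing and all values of the first lie below those of the second, so an
    ascending pair must straddle the cut. *)
Lemma two_blocks_ltn n (i j : 'I_n) : (i < j)%N ->
  (two_blocks n i < two_blocks n j)%N = (i < n./2 <= j)%N.
Proof.
rewrite !permE /= => ij; have := ltn_ord i; have := ltn_ord j.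
by do 2![case: ifP]; lia.
Qed.

(** The middle entry of an increasing triple would have to lie on both sides of the cut. *)
Lemma two_blocks_avoiders n : two_blocks n \in avoiders n pattern123.
Proof.
rewrite inE; apply/contains123P => -[i [j [k [/andP[ij jk]]]]].
by rewrite !two_blocks_ltn //; lia.
Qed.

Lemma inv_two_blocks_le n : (4 * Defs.inv (two_blocks n) <= n ^ 2)%N.
Proof.
pose A := finset (fun i : 'I_n => (i < n./2)%N).
have sub : finset.setX A (finset.setC A) \subset noninversions (two_blocks n).
  apply/fintype.subsetP => -[i j]; rewrite !inE /= -leqNgt => /andP[ik kj].
  have ij : (i < j)%N by lia.
  by rewrite two_blocks_ltn // ij ik kj.
have cA : #|A| = n./2.
  rewrite -sum1_card (eq_bigl (fun i : 'I_n => true && (i < n./2)%N)); last first.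
    by move=> i; rewrite inE.
  rewrite -(big_mkord (fun i => true && (i < n./2)%N) (fun _ => 1%N)).
  by rewrite -(big_nat_widen 0 n./2 n xpredT (fun _ => 1%N)) ?sum_nat_const_nat; lia.
have := subset_leq_card sub; rewrite cardsX cA.
have := cardsC A; rewrite card_ord cA => cAC.
have -> : #|finset.setC A| = (n - n./2)%N by lia.
(* The [+ 1] is the loss for odd [n], where the two blocks differ in length by one. *)
have kn : (n ^ 2 <= 4 * (n./2 * (n - n./2)) + 1)%N.
  by have := odd_double_half n; case: (odd n) => /= <-; nia.
have := card_noninversions (two_blocks n); have := double_bin2 n.
by move: (Defs.inv _) (n./2 * _)%N (n ^ 2)%N #|noninversions _| 'C(n, 2) kn; lia.
Qed.

(** * Bounds on Mallows probabilities *)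

Lemma inv_perm1 n : Defs.inv (1%g : 'S_n) = 0%N.
Proof.
rewrite /Defs.inv; apply/eqP; rewrite cards_eq0; apply/eqP/setP => -[i j].
by rewrite !inE !perm1 /=; lia.
Qed.

Lemma mallows_Z_ge1 (R : realType) (q : R) n : 0 < q -> 1 <= mallows_Z n q.
Proof.
move=> q_gt0; rewrite /mallows_Z (bigD1 (1%g : 'S_n)) //= inv_perm1 expr0 lerDl.
by apply: sumr_ge0 => s _; rewrite exprn_ge0 ?ltW.
Qed.

Lemma mallows_Z_le (R : realType) (q : R) n :
  0 < q -> q < 1 -> mallows_Z n q <= n`!%:R.
Proof.
move=> q_gt0 q_lt1; rewrite /mallows_Z -card_Sn -sumr_const; apply: ler_sum => s _.
by rewrite exprn_ile1 // ltW.
Qed.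

(** Only the term of [sigma] is kept, and [mallows_Z] is replaced by its upper bound. *)
Lemma mallows_ge (R : realType) (q : R) n (A : {set 'S_n}) sigma :
  0 < q -> q < 1 ->
  sigma \in A -> q ^+ Defs.inv sigma / n`!%:R <= mallows q A.
Proof.
move=> q_gt0 q_lt1 sA.
have Z_gt0 : 0 < mallows_Z n q by apply: lt_le_trans (mallows_Z_ge1 n q_gt0).
rewrite /mallows (bigD1 sigma) //= -[leLHS]addr0; apply: lerD.
  by rewrite ler_pM2l ?exprn_gt0 // lef_pV2 ?mallows_Z_le // posrE ?ltr0n ?fact_gt0.
by apply: sumr_ge0 => s _; rewrite divr_ge0 ?exprn_ge0 // ltW.
Qed.

(** Dividing by [mallows_Z], which is at least 1, only decreases a term; each term is then at most
    [q ^+ m], and there are at most n! of them. *)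
Lemma mallows_le (R : realType) (q : R) n (A : {set 'S_n}) m :
  0 < q -> q < 1 ->
  (forall sigma, sigma \in A -> (m <= Defs.inv sigma)%N) ->
  mallows q A <= n`!%:R * q ^+ m.
Proof.
move=> q_gt0 q_lt1 Am.
have Z_gt0 : 0 < mallows_Z n q by apply: lt_le_trans (mallows_Z_ge1 n q_gt0).
apply: (@le_trans _ _ (\sum_(sigma in A) q ^+ m)).
  apply: ler_sum => s sA; rewrite ler_pdivrMr //.
  rewrite (@le_trans _ _ (q ^+ m)) //; first by rewrite ler_wiXn2l ?Am // ltW.
  by rewrite ler_peMr ?mallows_Z_ge1 // exprn_ge0 // ltW.
rewrite sumr_const -[leLHS]mulr_natl ler_pM2r ?exprn_gt0 // ler_nat -card_Sn.
exact: max_card.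
Qed.

(** * Logarithmic estimates and the limit *)

Lemma ln_le_sqrt (R : realType) (x : R) : 0 < x -> ln x <= 2 * Num.sqrt x.
Proof.
move=> x0; rewrite -[X in ln X](sqr_sqrtr (ltW x0)) lnXn ?sqrtr_gt0 //.
by rewrite -[leLHS]mulr_natl ler_pM2l // ltW // ln_sublinear ?sqrtr_gt0.
Qed.

Lemma ln_fact_le (R : realType) n : ln (n`!%:R : R) <= n%:R * ln n%:R.
Proof.
case: n => [|n]; first by rewrite mul0r fact0 ln1.
rewrite mulr_natl -lnXn ?ltr0n // ler_ln ?posrE ?ltr0n ?fact_gt0 //.
by rewrite -natrX ler_nat leq_fact_expn.
Qed.

(** The square-root terms absorb ln n!, and [ln q * harmonic n] absorbs the linear loss in the
    inversion bound. The size is [n.+1], so that [harmonic n] is its reciprocal and the exponent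
    never divides by zero. *)
Lemma ln_mallows_avoiders123_bounds (R : realType) (q : R) n :
  0 < q -> q < 1 ->
  ln q / 4 - 2 * Num.sqrt (harmonic n)
    <= 1 / (n.+1 ^ 2)%:R * ln (mallows q (avoiders n.+1 pattern123))
    <= ln q / 4 + (2 * Num.sqrt (harmonic n) - ln q * harmonic n).
Proof.
move=> q0 q1; set h : R := harmonic n; set P := mallows _ _; pose N : R := n.+1%:R.
have N0 : 0 < N by rewrite ltr0n.
have F0 : 0 < (n.+1)`!%:R :> R by rewrite ltr0n fact_gt0.
have lnq : ln q < 0 by rewrite ln_lt0 // q0.
have lo := mallows_ge q0 q1 (two_blocks_avoiders n.+1).
have P0 : 0 < P by apply: lt_le_trans lo; rewrite divr_gt0 ?exprn_gt0.
(* [m4] is m/4 rounded up, the least number of inversions that [avoiders123_inv_ge] allows; the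
   subtraction truncates to 0 for size 1. *)
pose m := (n.+1 ^ 2 - 2 * n.+1)%N.
pose m4 := ((m + 3) %/ 4)%N.
have up : P <= n.+1`!%:R * q ^+ m4.
  apply: mallows_le => // s /avoiders123_inv_ge.
  by rewrite /m4 /m; move: (n.+1 ^ 2)%N; lia.
have lnF : ln (n.+1)`!%:R <= 2 * N ^+ 2 * Num.sqrt h.
  apply: (le_trans (ln_fact_le R _)).
  (* Since h = 1/N, both sides equal 2 N^(3/2); [field] checks this after N is written as the square
     of its root. *)
  have -> : 2 * N ^+ 2 * Num.sqrt h = N * (2 * Num.sqrt N).
    have sN : Num.sqrt N != 0 by rewrite gt_eqF // sqrtr_gt0.
    rewrite /h /harmonic /= sqrtrV ?ltW // -/N.
    rewrite -{1}(sqr_sqrtr (ltW N0)) -[in RHS](sqr_sqrtr (ltW N0)).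
    by rewrite sqrtr_sqr ger0_norm ?sqrtr_ge0 //; field.
  by rewrite ler_pM2l // ln_le_sqrt.
have sq : (n.+1 ^ 2)%:R = N ^+ 2 :> R by rewrite natrX.
have Nh : N * h = 1 by rewrite divff // gt_eqF.
have lnX k : ln (q ^+ k) = ln q * k%:R by rewrite lnXn // -[LHS]mulr_natr.
rewrite sq mul1r [_ * ln P]mulrC; apply/andP; split.
- rewrite ler_pdivlMr ?exprn_gt0 //.
  have := lo; rewrite -ler_ln ?posrE ?divr_gt0 ?exprn_gt0 // ln_div ?posrE ?exprn_gt0 //.
  rewrite lnX -/P.
  (* As [ln q] is negative, the upper bound on inversions turns into a lower bound on the
     logarithm. *)
  have : ln q * N ^+ 2 <= ln q * (4 * (Defs.inv (two_blocks n.+1))%:R).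
    have := inv_two_blocks_le n.+1; rewrite -(ler_nat R) natrM sq.
    by apply: ler_wnM2l; rewrite ltW.
  lra.
- rewrite ler_pdivrMr ?exprn_gt0 //.
  have := up; rewrite -ler_ln ?posrE ?mulr_gt0 ?exprn_gt0 // lnM ?posrE ?exprn_gt0 //.
  rewrite lnX.
  have : ln q * (4 * m4%:R + 2 * N) <= ln q * N ^+ 2.
    have : (n.+1 ^ 2 <= 4 * m4 + 2 * n.+1)%N by rewrite /m4 /m; move: (n.+1 ^ 2)%N; lia.
    rewrite -(ler_nat R) sq natrD !natrM.
    by apply: ler_wnM2l; rewrite ltW.
  have lnqN : ln q * N <= 0 by rewrite nmulr_rle0 // ltW.
  have -> : (ln q / 4 + (2 * Num.sqrt h - ln q * h)) * N ^+ 2 =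
    ln q / 4 * N ^+ 2 + 2 * N ^+ 2 * Num.sqrt h - ln q * N * (N * h) by ring.
  rewrite Nh; lra.
Qed.

Theorem theorem1 (R : realType) (q : R) (q_gt0 : 0 < q) (q_lt1 : q < 1) :
  (fun n : nat => mallows q (avoiders n pattern123) `^ (1 / (n ^ 2)%:R))
    @ \oo --> q `^ (1 / 4).
Proof.
have P_gt0 n : 0 < mallows q (avoiders n pattern123).
  apply: lt_le_trans (mallows_ge q_gt0 q_lt1 (two_blocks_avoiders n)).
  by rewrite divr_gt0 ?exprn_gt0 // ltr0n fact_gt0.
(* Positive bases avoid the special case of [powR] at 0, leaving exponentials of logarithms;
   continuity of [expR] reduces the claim to the exponents. *)
rewrite /powR gt_eqF //.
under eq_fun do rewrite gt_eqF //.
apply: continuous_cvg; first exact: continuous_expR.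
(* Shifting the index by one matches the size [n.+1] of the logarithmic bounds. *)
rewrite -cvg_shiftS mul1r mulrC.
have h0 := @cvg_harmonic R.
have s0 : 2 * Num.sqrt (harmonic n) @[n --> \oo] --> (0 : R).
  rewrite -[X in _ --> X](mulr0 2); apply: cvgM; first exact: cvg_cst.
  rewrite -[X in _ --> X]sqrtr0.
  by apply: continuous_cvg h0; exact: sqrt_continuous.
apply: (@squeeze_cvgr _ _ _ _
  (fun n => ln q / 4 - 2 * Num.sqrt (harmonic n))
  (fun n => ln q / 4 + (2 * Num.sqrt (harmonic n) - ln q * harmonic n))).
- by apply: nearW => n; exact: ln_mallows_avoiders123_bounds.
- rewrite -[X in _ --> X]subr0; apply: cvgB s0; exact: cvg_cst.
- rewrite -[X in _ --> X]addr0; apply: cvgD; first exact: cvg_cst.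
  rewrite -[X in _ --> X]subr0; apply: cvgB s0 _.
  rewrite -[X in _ --> X](mulr0 (ln q)); apply: cvgM h0; exact: cvg_cst.
Qed.
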